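(* Let $A$, $X$ and $q$ be integers with $$A\le q \qquad\text{and}\qquad X\ge q\ge X^{19/31},$$ and let ${\mathcal I}=\{B+1,\ldots,B+A\}$ be any interval of $A$ consecutive integers. Then $$ |{\mathcal E}(X;{\mathcal I},q)| \le \left(AX^{1/2}q^{-1/2}+A^{1/8}X^{1/4}q^{1/2}+A^{1/2}X^{1/4}q^{1/4}\right)q^{o(1)}. $$
   Context: $\tau(n)$ denotes the number of positive divisors of $n$. For integers $a$ and $q\ge 2$ let $S(X;a,q)=\sum_{n\le X,\ n\equiv a \pmod q}\tau(n)$. Let $\gamma$ be the Euler–Mascheroni constant, $\mu$ the Möbius function, and $r_d(a)=\sum_{e\mid \gcd(a,d)} e\,\mu(d/e)$ the Ramanujan sum. Define $P(T;q,a)=\sum_{d\mid q}\frac{r_d(a)}{d}\left(T-2\log d+2\gamma-1\right)$, $\mathrm{M}(X;a,q)=\frac{X}{q}P(\log X;q,a)$, and $\mathrm{R}(X;a,q)=S(X;a,q)-\mathrm{M}(X;a,q)$. For a set ${\mathcal A}$ of integers (residues modulo $q$) put ${\mathcal E}(X;{\mathcal A},q)=\sum_{a\in{\mathcal A}}\mathrm{R}(X;a,q)$. The notation $q^{o(1)}$ means a factor which, for every fixed $\varepsilon>0$, is at most $C(\varepsilon)q^{\varepsilon}$ with $C(\varepsilon)$ depending only on $\varepsilon$. *)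

(* Defs.v *)
From HB Require Import structures.
From mathcomp Require Import all_boot all_order all_algebra finmap lra.
From mathcomp Require Import all_classical all_reals all_analysis.
Set Implicit Arguments.
Unset Strict Implicit.
Unset Printing Implicit Defensive.
Import Order.TTheory GRing.Theory Num.Theory numFieldNormedType.Exports.
Local Open Scope fset_scope.
Local Open Scope ring_scope.

Definition tau (n : nat) : nat := size (divisors n).

(* [moebius 0 = 1] is a junk value; 0 never occurs as an argument below. *)
Definition moebius (n : nat) : int :=
  if all (fun p => logn p n == 1%N) (primes n) then (-1) ^+ size (primes n)
  else 0.

Definition ramanujan_sum (d : nat) (a : int) : int :=
  \sum_(e <- divisors (gcdn `|a| d)) e%:Z * moebius (d %/ e).

Definition gamma_seq {R : realType} (n : nat) : R :=
  \sum_(1 <= k < n.+1) k%:R^-1 - ln n%:R.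

Definition euler_gamma {R : realType} : R := limn (@gamma_seq R).

Lemma gamma_seq_cvg (R : realType) : cvgn (@gamma_seq R).
Proof.
have step (x : R) : 0 < x -> (x + 1)^-1 <= ln (x + 1) - ln x <= x^-1.
  move=> x0; have x10 : 0 < x + 1 by rewrite addr_gt0.
  apply/andP; split.
    rewrite -lerN2 opprB -ln_div ?posrE//.
    have -> : x / (x + 1) = 1 + - (x + 1)^-1.
      apply: (mulIf (lt0r_neq0 x10)).
      by rewrite mulrDl mulNr mulVf ?divfK ?gt_eqF// mul1r addrK.
    by apply: le_ln1Dx; rewrite ltrN2 invf_lt1// ltrDr.
  rewrite -ln_div ?posrE// mulrDl divff ?gt_eqF// mul1r.
  by apply: le_ln1Dx; rewrite (lt_trans (ltrN10 R)) ?invr_gt0.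
suff : cvgn (fun n => @gamma_seq R n.+1).
  by move=> /cvg_ex[l hl]; apply/cvg_ex; exists l; rewrite -cvg_shiftS.
apply: nonincreasing_is_cvgn.
  apply/nonincreasing_seqP => n; rewrite /gamma_seq big_nat_recr//=.
  have /andP[+ _] := step n.+1%:R (ltr0Sn _ _).
  by rewrite natr1; move: (ln _) (ln _) (\sum_(_ <= _ < _) _) (_^-1) => *; lra.
exists 0 => _ [n _ <-]; rewrite /gamma_seq subr_ge0.
have H m : ln m.+1%:R <= \sum_(1 <= k < m.+1) k%:R^-1 :> R.
  elim: m => [|m IH]; first by rewrite ln1 big_geq.
  rewrite big_nat_recr//=.
  have /andP[_] := step m.+1%:R (ltr0Sn _ _); move: IH.
  by rewrite natr1; move: (ln _) (ln _) (\sum_(_ <= _ < _) _) (_^-1) => *; lra.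
by apply: le_trans (H _); rewrite ler_ln ?posrE ?ltr0Sn// ler_nat.
Qed.

Section DivisorProgression.
Context {R : realType}.

Definition divisor_sum (X : nat) (a : int) (q : nat) : nat :=
  \sum_(1 <= n < X.+1 | (n%:Z == a %[mod q%:Z])%Z) tau n.

Definition main_poly (T : R) (q : nat) (a : int) : R :=
  \sum_(d <- divisors q)
    (ramanujan_sum d a)%:~R / d%:R * (T - 2 * ln d%:R + 2 * euler_gamma - 1).

Definition main_term (X : nat) (a : int) (q : nat) : R :=
  X%:R / q%:R * main_poly (ln X%:R) q a.

Definition remainder (X : nat) (a : int) (q : nat) : R :=
  (divisor_sum X a q)%:R - main_term X a q.

Definition error_sum (X : nat) (S : {fset int}) (q : nat) : R :=
  \sum_(a <- S) remainder X a q.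

End DivisorProgression.

Definition int_interval (B : int) (A : nat) : {fset int} :=
  [fset B + i%:Z | i in iota 1 A].

(* Main.v *)
(** The bound follows from the stronger estimate
    [|E(X; I, q)| <= (A + X^(1/2)) q^(o(1))], which implies the claim because
    [q <= X] and [X^(1/2) <= X^(19/31) <= q].

    By the hyperbola method the sum of [tau] counts, for [u <= U = floor (X^(1/2))],
    the [v <= Y] with [u v] congruent modulo [q] to an element of [I].  In the finite
    Fourier expansion of this count over the frequencies [h] modulo [q], those with
    [q | h u] give exactly [Y / q] times [g #{a in I : g | a}], [g = gcd (u, q)], which
    is a divisor sum of Ramanujan sums and produces the main term.  Every other
    frequency contributes at most a constant times [min (A, q / h) / ||h u||], where
    [||.||] is the distance to the nearest multiple of [q].  Collecting the pairs
    [(h, u)] with the same product [s = h u], of which there are at most [tau s],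
    bounds their total by [(A + U) q^(o(1))]. *)

Require Import Defs.
From mathcomp Require Import all_boot all_order all_algebra finmap zify ring lra.
From mathcomp Require Import all_classical all_reals all_analysis.
Import Order.TTheory GRing.Theory Num.Theory numFieldNormedType.Exports.
Set Implicit Arguments.
Unset Strict Implicit.
Unset Printing Implicit Defensive.
Local Open Scope ring_scope.

(** * Divisor sums, the Möbius function and Ramanujan sums *)

(** The free bound [N] gives divisor sums of different integers a common range, so that double sums
    can be exchanged. *)
Lemma sum_divisors (V : nmodType) (n N : nat) (F : nat -> V) :
  (0 < n)%N -> (n <= N)%N ->
  \sum_(d <- divisors n) F d = \sum_(1 <= d < N.+1 | (d %| n)%N) F d.
Proof.
move=> n0 nN; rewrite -[RHS]big_filter; apply: perm_big.
apply: uniq_perm; first exact: divisors_uniq.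
  by rewrite filter_uniq// iota_uniq.
move=> d; rewrite mem_filter mem_index_iota -dvdn_divisors//.
apply/idP/idP => [dn|/andP[]//]; rewrite dn /= (dvdn_gt0 n0 dn) /= ltnS.
exact: leq_trans (dvdn_leq n0 dn) nN.
Qed.

Lemma sum_multiples (V : nmodType) (e N : nat) (F : nat -> V) : (0 < e)%N ->
  \sum_(1 <= n < N.+1 | (e %| n)%N) F n =
  \sum_(1 <= m < (N %/ e).+1) F (e * m)%N.
Proof.
move=> e0; rewrite -[LHS]big_filter -[RHS](big_map (muln e) predT).
apply: perm_big; apply: uniq_perm.
- by rewrite filter_uniq// iota_uniq.
- by rewrite map_inj_uniq ?iota_uniq// => x y /eqP; rewrite eqn_pmul2l// => /eqP.
- move=> n; rewrite mem_filter mem_index_iota; apply/idP/mapP.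
    move=> /and3P[/dvdnP[k ->]]; rewrite muln_gt0 => /andP[k0 _].
    rewrite ltnS => keN; exists k; last by rewrite mulnC.
    by rewrite mem_index_iota k0 ltnS leq_divRL.
  move=> [k]; rewrite mem_index_iota ltnS leq_divRL// => /andP[k0 kN] ->.
  by rewrite dvdn_mulr//= muln_gt0 e0 k0 ltnS mulnC.
Qed.

Lemma count_multiples (e N : nat) : (0 < e)%N ->
  (\sum_(1 <= n < N.+1 | e %| n) 1 = N %/ e)%N.
Proof.
by move=> e0; rewrite (sum_multiples N (fun=> 1%N) e0) sum_nat_const_nat subn1 muln1.
Qed.

Lemma moebius_prime_mul (p n : nat) : prime p -> (0 < n)%N ->
  moebius (p * n) = if (p %| n)%N then 0 else - moebius n.
Proof.
move=> pp n0; have p0 := prime_gt0 pp; rewrite /moebius.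
have memp r : (r \in primes (p * n)) = (r == p) || (r \in primes n).
  by rewrite primesM// primes_prime// inE.
case: (boolP (p %| n)%N) => [pn|npn].
  suff /negbTE -> : ~~ all (fun r => logn r (p * n) == 1%N) (primes (p * n)) by [].
  apply/allPn; exists p; first by rewrite memp eqxx.
  by rewrite lognM// logn_prime// eqxx -[1%N]addn0 eqn_add2l lognE pp n0 pn.
have pnn : p \notin primes n by rewrite mem_primes negb_and negb_and npn !orbT.
have pq : perm_eq (primes (p * n)) (p :: primes n).
  by apply: uniq_perm; rewrite ?primes_uniq//= ?pnn ?primes_uniq.
rewrite (perm_size pq) (perm_all _ pq) /= lognM// logn_prime// eqxx.
rewrite (lognE p n) (negbTE npn) !andbF eqxx /=.
have -> : all (fun r => logn r (p * n) == 1%N) (primes n) =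
          all (fun r => logn r n == 1%N) (primes n).
  apply: eq_in_all => r rn; rewrite lognM// logn_prime//.
  by have [rp|//] := eqVneq r p; rewrite rp (negbTE pnn) in rn.
by case: ifP; rewrite ?exprS ?mulN1r ?oppr0.
Qed.

(** For a prime [p] dividing [n], the divisors [m] prime to [p] cancel against their multiples
    [p * m]; the remaining divisors are divisible by the square of [p] and contribute zero. *)
Lemma sum_moebius (n : nat) : (0 < n)%N ->
  \sum_(d <- divisors n) moebius d = (n == 1%N)%:R.
Proof.
move=> n0; case: eqP => [->|n1]; first by rewrite big_seq1.
have n2 : (1 < n)%N by lia.
have pp := pdiv_prime n2; have pn := pdiv_dvd n; set p := pdiv n in pp pn.
have p0 := prime_gt0 pp; have np0 : (0 < n %/ p)%N by rewrite divn_gt0// dvdn_leq.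
rewrite (@sum_divisors _ n n)// (bigID (fun d => p %| d)%N) /=.
under eq_bigl do rewrite andbC.
rewrite big_mkcondr (sum_multiples n (fun d => if (d %| n)%N then moebius d else 0)) //.
have -> : \sum_(1 <= m < (n %/ p).+1)
    (if (p * m %| n)%N then moebius (p * m) else 0) =
  - \sum_(1 <= m < n.+1 | (m %| n)%N && ~~ (p %| m)%N) moebius m.
  (* A divisor of [n] prime to [p] divides [n %/ p], so the range beyond [n %/ p] is empty. *)
  rewrite [in RHS](big_cat_nat (n := (n %/ p).+1))//=; last by rewrite ltnS leq_div.
  rewrite [X in _ + X]big_nat_cond [X in _ + X]big_pred0 ?addr0; last first.
    move=> i; apply/negP => /andP[/andP[ipn _]] /andP[idn npi].
    have : (i %| n %/ p)%N.
      rewrite -(@Gauss_dvdr i p); first by rewrite mulnC divnK.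
      by rewrite coprime_sym prime_coprime.
    by move/(dvdn_leq np0); lia.
  rewrite -sumrN [RHS]big_mkcond /=; apply: eq_big_nat => m /andP[m0 _].
  rewrite moebius_prime_mul//; case: (boolP (p %| m)%N) => [_|npm].
    by rewrite andbF; case: ifP.
  by rewrite andbT Gauss_dvd ?prime_coprime// pn.
by rewrite addNr.
Qed.

Lemma normr_moebius_le1 (n : nat) : `|moebius n| <= 1.
Proof. by rewrite /moebius; case: ifP; rewrite ?normr0// normrX normrN1 expr1n. Qed.

Lemma dvdn_gcd_absz (e d : nat) (a : int) :
  (e %| gcdn `|a| d)%N = (e%:Z %| a)%Z && (e %| d)%N.
Proof. by rewrite dvdn_gcd. Qed.

(** After exchanging the sums, the coefficient of [e] is the Möbius sum over the divisors of
    [g %/ e], which leaves only [e = g]. *)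
Lemma sum_ramanujan (g : nat) (a : int) : (0 < g)%N ->
  \sum_(d <- divisors g) ramanujan_sum d a = if (g%:Z %| a)%Z then g%:Z else 0.
Proof.
move=> g0; rewrite (@sum_divisors _ g g)//.
transitivity (\sum_(1 <= d < g.+1 | (d %| g)%N)
   \sum_(1 <= e < g.+1 | (e%:Z %| a)%Z && (e %| d)%N) e%:Z * moebius (d %/ e)).
  rewrite big_nat_cond [RHS]big_nat_cond; apply: eq_bigr => d /andP[/andP[d0 dg] _].
  rewrite /ramanujan_sum (@sum_divisors _ _ g) ?gcdn_gt0 ?d0 ?orbT//.
    by apply: eq_bigl => e; rewrite dvdn_gcd_absz.
  by apply: leq_trans (dvdn_leq d0 (dvdn_gcdr _ _)) _; rewrite -ltnS.
rewrite (exchange_big_dep_nat (fun e => (e%:Z %| a)%Z && (e %| g)%N)) /=; last first.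
  by move=> d e _ _ dg /andP[-> ed]; rewrite (dvdn_trans ed dg).
transitivity (\sum_(1 <= e < g.+1 | (e%:Z %| a)%Z && (e %| g)%N)
    e%:Z * (g == e)%:R).
  rewrite big_nat_cond [RHS]big_nat_cond.
  apply: eq_bigr => e /andP[/andP[e0 _] /andP[ea eg]].
  rewrite -big_distrr /=; congr (_ * _); rewrite ea /=.
  under eq_bigl do rewrite andbC.
  rewrite big_mkcondr (sum_multiples g (fun d => if (d %| g)%N then moebius (d %/ e) else 0))//.
  have ge0 : (0 < g %/ e)%N by rewrite divn_gt0// dvdn_leq.
  have -> : (g == e) = ((g %/ e)%N == 1%N) by rewrite -[RHS](eqn_pmul2r e0) divnK// mul1n.
  rewrite -sum_moebius// (@sum_divisors _ _ (g %/ e)%N)// [RHS]big_mkcond /=.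
  by apply: eq_bigr => f _; rewrite mulKn// dvdn_divRL// mulnC.
case: (boolP (g%:Z %| a)%Z) => ga.
  rewrite big_mkcond big_nat_recr//= ga dvdnn /= eqxx mulr1 big_nat_cond big1 ?add0r//.
  by move=> e /andP[/andP[_ eg] _]; rewrite gtn_eqF// mulr0 if_same.
rewrite big1// => e /andP[ea _]; case: eqP => [ge|]; last by rewrite mulr0.
by rewrite ge ea in ga.
Qed.

(** * The divisor bound *)

(** A divisor [d] of [m * n] is the product of [gcdn d m], which divides [m], and its cofactor,
    which divides [n]. *)
Lemma tau_mul_le (m n : nat) : (0 < m)%N -> (0 < n)%N ->
  (tau (m * n) <= tau m * tau n)%N.
Proof.
move=> m0 n0; rewrite /tau -(size_allpairs muln).
apply: uniq_leq_size => [|d]; first exact: divisors_uniq.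
rewrite -dvdn_divisors ?muln_gt0 ?m0// => dmn.
have d0 : (0 < d)%N by apply: dvdn_gt0 dmn; rewrite muln_gt0 m0.
have g0 : (0 < gcdn d m)%N by rewrite gcdn_gt0 d0.
apply/allpairsP; exists (gcdn d m, d %/ gcdn d m)%N; split => /=.
- by rewrite -dvdn_divisors// dvdn_gcdr.
- rewrite -dvdn_divisors//.
  have cop : coprime (d %/ gcdn d m) (m %/ gcdn d m).
    rewrite /coprime -(eqn_pmul2r g0) muln_gcdl !divnK ?dvdn_gcdl ?dvdn_gcdr//.
    by rewrite mul1n.
  rewrite -(Gauss_dvdr _ cop) -(dvdn_pmul2r g0) mulnAC.
  by rewrite !divnK ?dvdn_gcdl ?dvdn_gcdr.
- by rewrite mulnC divnK// dvdn_gcdl.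
Qed.

Lemma tau_pfactor_le (p k : nat) : prime p -> (tau (p ^ k) <= k.+1)%N.
Proof.
move=> pp; rewrite /tau -[k.+1](size_iota 0) -(size_map (expn p) (iota 0 k.+1)).
apply: uniq_leq_size => [|d]; first exact: divisors_uniq.
rewrite -dvdn_divisors ?expn_gt0 ?prime_gt0// => /(dvdn_pfactor _ _ pp)[j jk ->].
by apply: map_f; rewrite mem_iota.
Qed.

Lemma tau_prod_primes_le (s : seq nat) (f : nat -> nat) : all prime s ->
  (tau (\prod_(p <- s) p ^ f p) <= \prod_(p <- s) (f p).+1)%N.
Proof.
elim: s => [|p s IH]; first by rewrite !big_nil.
move=> /= /andP[pp sp]; rewrite !big_cons.
apply: leq_trans (tau_mul_le _ _) _; first by rewrite expn_gt0 prime_gt0.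
  rewrite big_seq_cond; apply: prodn_cond_gt0 => r /andP[rs _].
  by rewrite expn_gt0 prime_gt0// (allP sp).
by apply: leq_mul; rewrite ?tau_pfactor_le ?IH.
Qed.

Lemma prod_primes (n : nat) : (0 < n)%N ->
  n = (\prod_(p <- primes n) p ^ logn p n)%N.
Proof.
move=> n0; rewrite {1}(prod_prime_decomp n0) prime_decompE big_map.
by apply: eq_bigr.
Qed.

(* Only the boundedly many primes p with p^eps < 2 can have k + 1 > p^(k eps),
   and each of them loses at most the factor 1 + 1 / (eps ln 2). *)
Lemma divisor_bound (R : realType) (eps : R) : 0 < eps ->
  exists2 C : R, 1 <= C & forall n, (0 < n)%N -> (tau n)%:R <= C * n%:R `^ eps.
Proof.
move=> eps0; pose L : R := 1 + (eps * ln 2)^-1.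
have ln2 : 0 < ln 2 :> R by rewrite ln_gt0// ltr1n.
have L1 : 1 <= L by rewrite /L lerDl invr_ge0 mulr_ge0// ltW.
pose P : nat := (Num.truncn (2 `^ eps^-1 : R)).+1.
have Plt : 2 `^ eps^-1 < P%:R :> R by apply: truncnS_gt; rewrite powR_ge0.
pose c (p : nat) : R := if (p < P)%N then L else 1.
have cge1 p : 1 <= c p by rewrite /c; case: ifP.
have local p k : prime p -> k.+1%:R <= c p * (p ^ k)%:R `^ eps.
  move=> pp; have p2 : 2 <= p%:R :> R by rewrite ler_nat prime_gt1.
  have p0 : 0 < p%:R :> R by rewrite ltr0n prime_gt0.
  rewrite natrX -powR_mulrn ?(ltW p0)// -powRrM.
  rewrite /c; case: ltnP => [pP|Pp].
    have : 1 + (k%:R * eps) * ln 2 <= p%:R `^ (k%:R * eps).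
      apply: le_trans (_ : 2 `^ (k%:R * eps) <= _); last first.
        by apply: ge0_ler_powR; rewrite ?mulr_ge0 ?nnegrE// ltW.
      by rewrite /powR pnatr_eq0 /= expR_ge1Dx.
    (* In the expanded product, [(eps * ln 2)^-1] times [k * eps * ln 2] supplies the required
       [k]. *)
    move=> h; apply: le_trans (_ : L * (1 + (k%:R * eps) * ln 2) <= _); last first.
      by rewrite ler_pM2l// (lt_le_trans ltr01).
    have -> : L * (1 + k%:R * eps * ln 2) =
        1 + (eps * ln 2)^-1 + k%:R * (eps * ln 2) + k%:R.
      by rewrite /L; field; rewrite !gt_eqF.
    have h1 : 0 <= k%:R * (eps * ln 2) by rewrite !mulr_ge0// ltW.
    have h2 : 0 <= (eps * ln 2)^-1 by rewrite invr_ge0 mulr_ge0// ltW.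
    by rewrite -natr1; lra.
  rewrite mul1r mulrC powRrM powR_mulrn ?powR_ge0//.
  apply: le_trans (_ : 2 ^+ k <= _); first by rewrite -natrX ler_nat ltn_expl.
  apply: lerXn2r; rewrite ?nnegrE ?powR_ge0//.
  have -> : 2 = (2 `^ eps^-1) `^ eps :> R by rewrite -powRrM mulVf ?gt_eqF// powRr1.
  apply: ge0_ler_powR; rewrite ?nnegrE ?powR_ge0 ?ltW//.
  by apply: lt_le_trans Plt _; rewrite ler_nat.
exists (L ^+ P); first by rewrite exprn_ege1.
move=> n n0.
have main (s : seq nat) (f : nat -> nat) : all prime s ->
   (\prod_(p <- s) (f p).+1)%N%:R <=
   (\prod_(p <- s) c p) * (\prod_(p <- s) p ^ f p)%N%:R `^ eps.
  elim: s => [|p s IH]; first by rewrite !big_nil powR1 mulr1.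
  move=> /= /andP[pp sp]; rewrite !big_cons !natrM powRM// mulrACA.
  by apply: ler_pM => //; [exact: local|exact: IH].
have ap : all prime (primes n) by apply/allP => p; rewrite mem_primes => /andP[].
rewrite {1}(prod_primes n0).
apply: le_trans (_ : (\prod_(p <- primes n) (logn p n).+1)%N%:R <= _).
  by rewrite ler_nat tau_prod_primes_le.
apply: le_trans (main _ _ ap) _; rewrite -prod_primes//.
apply: ler_wpM2r; first exact: powR_ge0.
rewrite (bigID (fun p => p < P)%N) /= [X in _ * X]big1 ?mulr1; last first.
  by move=> p; rewrite /c => /negbTE ->.
rewrite (eq_bigr (fun=> L)) => [|p]; last by rewrite /c => ->.
rewrite big_const_seq iter_mulr_1 ler_weXn2l//.
rewrite -size_filter -[leqRHS](size_iota 0 P).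
apply: uniq_leq_size; first by rewrite filter_uniq// primes_uniq.
by move=> p; rewrite mem_filter mem_iota add0n => /andP[->].
Qed.

(** * Sums of cosines along arithmetic progressions *)

Lemma sum_cos_telescope (R : realType) (al b : R) (n : nat) :
  2 * sin (al / 2) * \sum_(1 <= i < n.+1) cos (b + i%:R * al) =
  sin (b + (n%:R + 2^-1) * al) - sin (b + al / 2).
Proof.
elim: n => [|n IH]; first by rewrite big_geq// mulr0 add0r [2^-1 * _]mulrC subrr.
rewrite big_nat_recr//= mulrDr IH.
have -> : b + (n.+1%:R + 2^-1) * al = (b + n.+1%:R * al) + al / 2 by ring.
have -> : b + (n%:R + 2^-1) * al = (b + n.+1%:R * al) - al / 2.
  by rewrite -natr1; field.
move: (b + n.+1%:R * al) (sin (b + al / 2)) => x y.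
by rewrite sinB sinD; ring.
Qed.

(** The telescoped sum is a difference of two sines, of size at most 2. The product form also covers
    a vanishing sine. *)
Lemma norm_sum_cos_le (R : realType) (al b : R) (n : nat) :
  `|\sum_(1 <= i < n.+1) cos (b + i%:R * al)| * `|sin (al / 2)| <= 1.
Proof.
have := congr1 Num.norm (sum_cos_telescope al b n).
rewrite !normrM ger0_norm// => h.
have : `|sin (b + (n%:R + 2^-1) * al) - sin (b + al / 2)| <= 2.
  apply: le_trans (ler_normB _ _) _.
  by have := sin_max (b + (n%:R + 2^-1) * al); have := sin_max (b + al / 2); lra.
by rewrite -h; lra.
Qed.

Lemma norm_sum_cos_le_card (R : realType) (F : nat -> R) (n : nat) :
  `|\sum_(1 <= i < n.+1) cos (F i)| <= n%:R.
Proof.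
apply: le_trans (ler_norm_sum _ _ _) _.
apply: le_trans (ler_sum _ (fun i _ => cos_max (F i))) _.
by rewrite sumr_const_nat subn1.
Qed.

Lemma sin_natpi (R : realType) (n : nat) : sin (n%:R * pi) = 0 :> R.
Proof. by rewrite mulr_natl -[_ *+ _]add0r alternatingn ?sin0 ?mulr0//; exact: sinDpi. Qed.

Lemma sin_intpi (R : realType) (n : int) : sin (n%:~R * pi) = 0 :> R.
Proof.
case: n => n; first exact: sin_natpi.
by rewrite NegzE rmorphN mulNr sinN sin_natpi oppr0.
Qed.

Lemma cos_int2pi (R : realType) (n : int) : cos (n%:~R * (2 * pi)) = 1 :> R.
Proof.
have -> : n%:~R * (2 * pi) = (n%:~R * pi) *+ 2 :> R by rewrite mulr2n; ring.
by rewrite cos_mulr2n cos2sin2 sin_intpi expr0n /= subr0 mulr2n; lra.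
Qed.

Lemma cosD_int2pi (R : realType) (x : R) (n : int) : cos (x + n%:~R * (2 * pi)) = cos x.
Proof.
rewrite cosD cos_int2pi.
have -> : n%:~R * (2 * pi) = (n * 2)%:~R * pi :> R by rewrite intrM; ring.
by rewrite sin_intpi; ring.
Qed.

Lemma norm_sinD_natpi (R : realType) (x : R) (n : nat) :
  `|sin (x + n%:R * pi)| = `|sin x|.
Proof.
by rewrite mulr_natl alternatingn ?normrM ?normrX ?normrN1 ?expr1n ?mul1r//; exact: sinDpi.
Qed.

(** Write [sin x] as [2 * sin (x / 2) * cos (x / 2)] and apply the mean value theorem to
    [sin (x / 2)]: both cosines that appear are at least [cos (pi / 4)], whose square is 1/2. *)
Lemma sin_ge_half (R : realType) (x : R) : 0 <= x <= pi / 2 -> x / 2 <= sin x.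
Proof.
move=> /andP[x0 xp]; have pi0 := pi_gt0 R.
have cmono y : 0 <= y <= pi / 4 -> cos (pi / 4) <= cos y.
  move=> /andP[y0 yp]; rewrite leNgt; apply/negP => h.
  by move: h; rewrite ltr_cos ?in_itv /=; [lra|lra|lra].
have c0 : 0 <= cos (pi / 4) :> R by apply: cos_ge0_pihalf; lra.
have c2 : cos (pi / 4) ^+ 2 = 2^-1 :> R.
  have := cos_pihalf R; have -> : pi / 2 = (pi / 4) *+ 2 :> R by rewrite mulr2n; field.
  by rewrite cos_mulr2n mulr2n; lra.
have hx : 0 <= x / 2 by lra.
have [|z] := @MVT_segment R sin cos 0 (x / 2) hx (fun z _ => is_derive_sin z).
  exact/continuous_subspaceT/continuous_sin.
rewrite in_itv /= sin0 !subr0 => /andP[z0 zx] sx.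
have cz : cos (pi / 4) <= cos z by apply: cmono; lra.
have cx : cos (pi / 4) <= cos (x / 2) by apply: cmono; lra.
have -> : sin x = 2 * (cos z * (x / 2) * cos (x / 2)).
  have {1}-> : x = (x / 2) *+ 2 by rewrite mulr2n; field.
  by rewrite sin_mulr2n sx mulr2n; ring.
have : cos (pi / 4) ^+ 2 <= cos z * cos (x / 2) by rewrite expr2 ler_pM.
by rewrite c2; move: (cos z) (cos _) => u v; nra.
Qed.

(* Within a factor 2 of the inverse distance from [n] to the nearest multiple of [q];
   a junk value if [q] divides [n]. *)
Definition recip_dist (R : realType) (q n : nat) : R :=
  (n %% q)%:R^-1 + (q - n %% q)%:R^-1.

Lemma sin_ge_dist (R : realType) (q m : nat) : (m <= q)%N -> (0 < q)%N ->
  (minn m (q - m))%:R / q%:R <= `|sin (m%:R * pi / q%:R)| :> R.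
Proof.
move=> mq q0; have q0R : 0 < q%:R :> R by rewrite ltr0n.
have half k : (k + k <= q)%N -> k%:R / q%:R <= `|sin (k%:R * pi / q%:R)| :> R.
  move=> kq; apply: le_trans (ler_norm _).
  have kq' : k%:R / q%:R <= 2^-1 :> R.
    rewrite ler_pdivrMr//; have : (k + k)%:R <= q%:R :> R by rewrite ler_nat.
    by rewrite natrD; lra.
  have k0 : 0 <= k%:R / q%:R :> R by rewrite divr_ge0.
  (* The bound [2 <= pi] makes up for the factor 1/2 in [sin_ge_half]. *)
  have pi2 := pi_ge2 R.
  have -> : k%:R * pi / q%:R = k%:R / q%:R * pi :> R by rewrite mulrAC.
  apply: le_trans (sin_ge_half _); first by nra.
  by apply/andP; split; nra.
case: (leqP (m + m) q) => h; first by rewrite (minn_idPl _); [exact: half|lia].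
rewrite (minn_idPr _); last by lia.
apply: le_trans (half (q - m)%N _) _; first by lia.
have -> : (q - m)%:R * pi / q%:R = - (m%:R * pi / q%:R) + 1%:R * pi :> R.
  by rewrite natrB//; field; rewrite gt_eqF.
by rewrite norm_sinD_natpi sinN normrN.
Qed.

(** By periodicity only [n %% q] matters, and the inverse of the smaller of its distances to 0 and
    [q] is at most the sum of both inverses. *)
Lemma inv_sin_le (R : realType) (q n : nat) : (0 < q)%N -> ~~ (q %| n)%N ->
  0 < `|sin (n%:R * pi / q%:R)| :> R /\
  `|sin (n%:R * pi / q%:R)|^-1 <= q%:R * recip_dist R q n.
Proof.
move=> q0 qn; have q0R : 0 < q%:R :> R by rewrite ltr0n.
have mq : (n %% q < q)%N by rewrite ltn_mod.
have m0 : (0 < n %% q)%N by rewrite lt0n.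
have -> : `|sin (n%:R * pi / q%:R)| = `|sin ((n %% q)%:R * pi / q%:R)| :> R.
  rewrite {1}(divn_eq n q) natrD natrM.
  have -> : ((n %/ q)%:R * q%:R + (n %% q)%:R) * pi / q%:R =
      (n %% q)%:R * pi / q%:R + (n %/ q)%:R * pi :> R by field; rewrite gt_eqF.
  by rewrite norm_sinD_natpi.
have h := @sin_ge_dist R q _ (ltnW mq) q0.
have mn0 : 0 < (minn (n %% q) (q - n %% q))%:R :> R.
  by rewrite ltr0n leq_min m0 subn_gt0.
have s0 : 0 < (minn (n %% q) (q - n %% q))%:R / q%:R :> R by rewrite divr_gt0.
split; first exact: lt_le_trans h.
apply: le_trans (_ : ((minn (n %% q) (q - n %% q))%:R / q%:R)^-1 <= _).
  by rewrite lef_pV2 ?posrE// (lt_le_trans s0).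
rewrite invf_div ler_pM2l// /recip_dist /minn.
by case: ifP => _; rewrite ?lerDl ?lerDr invr_ge0.
Qed.

(** Orthogonality of additive characters in real form. If [q] does not divide [n], the two ends of
    the telescoped sum differ by whole turns and cancel, while the factor [sin (al / 2)] is nonzero
    by [inv_sin_le]. *)
Lemma sum_cos_orthogonal (R : realType) (q : nat) (n : int) : (0 < q)%N ->
  \sum_(1 <= h < q.+1) cos (h%:R * (n%:~R * (2 * pi) / q%:R)) =
  (if (q%:Z %| n)%Z then q%:R else 0) :> R.
Proof.
move=> q0; have q0R : 0 < q%:R :> R by rewrite ltr0n.
case: ifPn => qn.
  have [k ->] := dvdzP qn.
  rewrite (eq_bigr (fun=> 1)) ?sumr_const_nat ?subn1// => h _.
  have -> : h%:R * ((k * q%:Z)%:~R * (2 * pi) / q%:R) =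
      (h%:Z * k)%:~R * (2 * pi) :> R.
    by rewrite !intrM -!pmulrn; field; rewrite gt_eqF.
  exact: cos_int2pi.
pose al : R := n%:~R * (2 * pi) / q%:R.
have := sum_cos_telescope al 0 q.
have -> : 0 + (q%:R + 2^-1) * al = al / 2 + n%:~R * (2 * pi).
  by rewrite /al; field; rewrite gt_eqF.
have -> : sin (al / 2 + n%:~R * (2 * pi)) = sin (al / 2).
  by rewrite -!cosBpihalf addrAC cosD_int2pi.
rewrite add0r subrr => /eqP; rewrite mulf_eq0 => /orP[|/eqP].
  rewrite mulf_eq0 pnatr_eq0 /= => /eqP s0.
  have e : sin (n%:~R * pi / q%:R) = 0 :> R.
    by rewrite -[RHS]s0 /al; congr sin; field; rewrite gt_eqF.
  have hs : `|sin (`|n|%N%:R * pi / q%:R)| = 0 :> R.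
    have -> : `|n|%N%:R = `|n%:~R| :> R by rewrite -intr_norm -abszE -pmulrn.
    have [n0|n0] := lerP 0 (n%:~R : R).
      by rewrite (ger0_norm n0) e normr0.
    by rewrite (ltr0_norm n0) !mulNr sinN e oppr0 normr0.
  have [] := @inv_sin_le R q `|n|%N q0; first by apply: contraNN qn.
  by rewrite hs ltxx.
by under eq_bigr do rewrite add0r.
Qed.

(** The addition formula splits the double sum into two products of single sums. The sines become
    cosines with phase shifted by [pi / 2], which is why the hypothesis allows every phase [c]. *)
Lemma norm_sum2_cos_le (R : realType) (al be b M : R) (Y A : nat) :
  0 < `|sin (al / 2)| ->
  (forall c, `|\sum_(1 <= i < A.+1) cos (c + i%:R * be)| <= M) ->
  `|\sum_(1 <= v < Y.+1) \sum_(1 <= i < A.+1) cos (v%:R * al - (b + i%:R * be))| <=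
  2 * `|sin (al / 2)|^-1 * M.
Proof.
move=> s0 hM; set S := `|sin (al / 2)|^-1.
have hS c : `|\sum_(1 <= v < Y.+1) cos (c + v%:R * al)| <= S.
  by rewrite -[S]mul1r ler_pdivlMr// norm_sum_cos_le.
have -> : \sum_(1 <= v < Y.+1) \sum_(1 <= i < A.+1) cos (v%:R * al - (b + i%:R * be)) =
  (\sum_(1 <= v < Y.+1) cos (0 + v%:R * al)) * (\sum_(1 <= i < A.+1) cos (b + i%:R * be)) +
  (\sum_(1 <= v < Y.+1) cos (- (pi / 2) + v%:R * al)) *
  (\sum_(1 <= i < A.+1) cos ((b - pi / 2) + i%:R * be)).
  rewrite !big_distrl -big_split /=; apply: eq_bigr => v _.
  rewrite !big_distrr -big_split /=; apply: eq_bigr => i _.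
  by rewrite add0r [- (pi / 2) + _]addrC cosBpihalf [b - _ + _]addrAC cosBpihalf cosB.
apply: le_trans (ler_normD _ _) _; rewrite !normrM.
have := ler_pM (normr_ge0 _) (normr_ge0 _) (hS 0) (hM b).
have := ler_pM (normr_ge0 _) (normr_ge0 _) (hS (- (pi / 2))) (hM (b - pi / 2)).
by move=> h1 h2; apply: le_trans (lerD h2 h1) _; lra.
Qed.

(** * Fourier expansion of the count of products falling in the interval *)

Definition interval_hits (R : realType) (A q : nat) (B : int) (n : nat) : R :=
  \sum_(1 <= i < A.+1) (n%:Z == B + i%:Z %[mod q%:Z])%Z%:R.

(** Divided by [q], this is the mean of [interval_hits] at [u * v] as [v] runs over a full period
    modulo [q]. *)
Definition gcd_weight (R : realType) (A q : nat) (B : int) (u : nat) : R :=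
  \sum_(1 <= i < A.+1)
    (if ((gcdn u q)%:Z %| B + i%:Z)%Z then (gcdn u q)%:R else 0).

(** The cosine is the real part of the character of frequency [h]; the imaginary parts cancel over
    all [h], so real numbers suffice. *)
Definition hit_mode (R : realType) (A q : nat) (B : int) (u Y h : nat) : R :=
  \sum_(1 <= v < Y.+1) \sum_(1 <= i < A.+1)
    cos (h%:R * (((u * v)%:Z - (B + i%:Z))%:~R * (2 * pi) / q%:R)).

Lemma sum_hits_fourier (R : realType) (A q : nat) (B : int) (u Y : nat) : (0 < q)%N ->
  q%:R * \sum_(1 <= v < Y.+1) interval_hits R A q B (u * v) =
  \sum_(1 <= h < q.+1) hit_mode R A q B u Y h.
Proof.
move=> q0; rewrite /hit_mode [RHS]exchange_big /= mulr_sumr; apply: eq_bigr => v _.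
rewrite exchange_big /= /interval_hits mulr_sumr; apply: eq_bigr => i _.
rewrite sum_cos_orthogonal// eqz_mod_dvd.
by case: ifP; rewrite ?mulr1 ?mulr0.
Qed.

(** When [q] divides [h * u], the variable [v] changes the angle by whole turns only. *)
Lemma hit_mode_diag (R : realType) (A q : nat) (B : int) (u Y h : nat) :
  (0 < q)%N -> (q %| h * u)%N ->
  hit_mode R A q B u Y h =
  Y%:R * \sum_(1 <= i < A.+1) cos (h%:R * ((B + i%:Z)%:~R * (2 * pi) / q%:R)).
Proof.
move=> q0 /dvdnP[k hk]; have q0R : q%:R != 0 :> R by rewrite pnatr_eq0 -lt0n.
have hkR : h%:R * u%:R = k%:R * q%:R :> R by rewrite -!natrM hk.
rewrite /hit_mode (eq_bigr (fun=> \sum_(1 <= i < A.+1)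
    cos (h%:R * ((B + i%:Z)%:~R * (2 * pi) / q%:R)))); last first.
  move=> v _; apply: eq_bigr => i _.
  rewrite -[RHS]cosN -[RHS](@cosD_int2pi _ _ (k%:Z * v%:Z)); congr cos.
  rewrite [in LHS]rmorphB /= -pmulrn natrM intrM -!pmulrn.
  have -> : h%:R * ((u%:R * v%:R - (B + i%:Z)%:~R) * (2 * pi) / q%:R) =
     (h%:R * u%:R) * v%:R * (2 * pi) / q%:R
     - h%:R * ((B + i%:Z)%:~R * (2 * pi) / q%:R) :> R by field.
  by rewrite hkR; field.
by rewrite sumr_const_nat subn1 [RHS]mulr_natl.
Qed.

(** The sum over [v] is bounded by the inverse sine uniformly in [Y]; the sum over [i] by the better
    of its length and its inverse sine. *)
Lemma hit_mode_offdiag (R : realType) (A q : nat) (B : int) (u Y h : nat) :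
  (0 < q)%N -> ~~ (q %| h * u)%N ->
  `|hit_mode R A q B u Y h| <=
  2 * (q%:R * recip_dist R q (h * u)) * Num.min A%:R (q%:R * recip_dist R q h).
Proof.
move=> q0 nqhu; have q0R : q%:R != 0 :> R by rewrite pnatr_eq0 -lt0n.
have nqh : ~~ (q %| h)%N by apply: contraNN nqhu => /dvdn_mulr ->.
have [s0 s1] := @inv_sin_le R q _ q0 nqhu.
have [t0 t1] := @inv_sin_le R q _ q0 nqh.
pose al : R := (h * u)%:R * (2 * pi) / q%:R.
pose be : R := h%:R * (2 * pi) / q%:R.
have al2 : al / 2 = (h * u)%:R * pi / q%:R by rewrite /al; field.
have be2 : be / 2 = h%:R * pi / q%:R by rewrite /be; field.
rewrite -al2 in s0 s1; rewrite -be2 in t0 t1.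
have -> : hit_mode R A q B u Y h = \sum_(1 <= v < Y.+1) \sum_(1 <= i < A.+1)
   cos (v%:R * al - (h%:R * B%:~R * (2 * pi) / q%:R + i%:R * be)).
  apply: eq_bigr => v _; apply: eq_bigr => i _; congr cos.
  by rewrite rmorphB rmorphD /= -!pmulrn !natrM /al /be natrM; field.
apply: le_trans (@norm_sum2_cos_le _ _ _ _ (Num.min A%:R (q%:R * recip_dist R q h)) _ _ s0 _) _.
  move=> c; rewrite le_min norm_sum_cos_le_card /=; apply: le_trans t1.
  by rewrite -[leRHS]mul1r ler_pdivlMr// norm_sum_cos_le.
have d0 n : 0 <= recip_dist R q n by rewrite addr_ge0.
apply: ler_wpM2r; first by rewrite le_min ler0n mulr_ge0.
by rewrite ler_pM2l.
Qed.

(** With [g = gcdn u q], the frequencies in question are the [g] multiples of [q %/ g], so their sum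
    is an orthogonality relation modulo [g]. *)
Lemma sum_hit_modes_diag (R : realType) (A q : nat) (B : int) (u Y : nat) :
  (0 < q)%N ->
  \sum_(1 <= h < q.+1 | (q %| h * u)%N) hit_mode R A q B u Y h =
  Y%:R * gcd_weight R A q B u.
Proof.
move=> q0; set g := gcdn u q; have g0 : (0 < g)%N by rewrite gcdn_gt0 q0 orbT.
have gq : (g %| q)%N by rewrite dvdn_gcdr.
have gu : (g %| u)%N by rewrite dvdn_gcdl.
have qg0 : (0 < q %/ g)%N by rewrite divn_gt0// dvdn_leq.
have cond h : (q %| h * u)%N = (q %/ g %| h)%N.
  have cop : coprime (q %/ g) (u %/ g).
    rewrite /coprime -(eqn_pmul2r g0) muln_gcdl !divnK// mul1n.
    by rewrite gcdnC.
  by rewrite -{1}(divnK gq) -{1}(divnK gu) mulnA dvdn_pmul2r// Gauss_dvdl.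
rewrite (eq_bigr (fun h => Y%:R * \sum_(1 <= i < A.+1)
   cos (h%:R * ((B + i%:Z)%:~R * (2 * pi) / q%:R)))); last first.
  by move=> h qhu; rewrite hit_mode_diag.
rewrite -mulr_sumr; congr (_ * _); rewrite exchange_big /=; apply: eq_bigr => i _.
rewrite -(@sum_cos_orthogonal R g)//; under eq_bigl do rewrite cond.
rewrite sum_multiples//.
have -> : (q %/ (q %/ g))%N = g by rewrite -{1}(divnK gq) mulKn.
apply: eq_bigr => j _; congr cos.
have -> : q%:R = (q %/ g)%:R * g%:R :> R by rewrite -natrM divnK.
by rewrite natrM; field; rewrite !pnatr_eq0 -!lt0n g0.
Qed.

Lemma recip_dist_ge0 (R : realType) (q n : nat) : 0 <= recip_dist R q n.
Proof. by rewrite addr_ge0. Qed.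

(** Replacing [h] by [q - h] negates [h * u] modulo [q], which swaps the two summands of
    [recip_dist]. *)
Lemma recip_dist_rev (R : realType) (q h u : nat) : (0 < h < q)%N ->
  ~~ (q %| h * u)%N -> recip_dist R q ((q - h) * u) = recip_dist R q (h * u).
Proof.
move=> /andP[h0 hq] nq; have q0 : (0 < q)%N by lia.
have e : (((q - h) * u) %% q = q - (h * u) %% q)%N.
  have mq : ((h * u) %% q < q)%N by rewrite ltn_mod.
  have m0 : (0 < (h * u) %% q)%N by rewrite lt0n.
  rewrite -[RHS](@modn_small _ q); last by lia.
  apply/eqP; rewrite -(eqn_modDr (h * u)) -mulnDl subnK ?(ltnW hq)//.
  by rewrite modnMr -modnDmr subnK ?(ltnW mq)// modnn.
rewrite /recip_dist e addrC; congr (_^-1 + _); congr (_%:R).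
by rewrite subKn// ltnW// ltn_mod.
Qed.

(** The diagonal frequencies cancel the expected count. In the others, the minimum with a sum is at
    most the sum of the minima with [q / h] and [q / (q - h)]; reflecting [h] identifies the two
    parts and turns the constant 2 of [hit_mode_offdiag] into 4. *)
Lemma hits_discrepancy (R : realType) (A q : nat) (B : int) (u Y : nat) :
  (0 < q)%N ->
  `|\sum_(1 <= v < Y.+1) interval_hits R A q B (u * v)
    - Y%:R / q%:R * gcd_weight R A q B u| <=
  4 * \sum_(1 <= h < q | ~~ (q %| h * u)%N)
        recip_dist R q (h * u) * Num.min A%:R (q%:R / h%:R).
Proof.
move=> q0; have q0R : 0 < q%:R :> R by rewrite ltr0n.
set S := \sum_(1 <= v < _) _; set D := \sum_(1 <= h < q | _) _.
have -> : S - Y%:R / q%:R * gcd_weight R A q B u =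
   q%:R^-1 * \sum_(1 <= h < q.+1 | ~~ (q %| h * u)%N) hit_mode R A q B u Y h.
  apply: (mulfI (lt0r_neq0 q0R)); rewrite mulVKf ?gt_eqF// mulrBr.
  rewrite sum_hits_fourier// (bigID (fun h => q %| h * u)%N) /=.
  rewrite sum_hit_modes_diag// mulrA [q%:R * _]mulrC divfK ?gt_eqF//.
  by rewrite addrAC subrr add0r.
rewrite normrM gtr0_norm ?invr_gt0// mulrC ler_pdivrMr//.
apply: le_trans (ler_norm_sum _ _ _) _.
(* The top frequency [h = q] is diagonal and drops out. *)
rewrite big_mkcond big_nat_recr//= dvdn_mulr//= addr0 -big_mkcond /=.
pose G h : R := if (q %| h * u)%N then 0
  else recip_dist R q (h * u) * Num.min A%:R (q%:R / h%:R).
have GE : D = \sum_(1 <= h < q) G h.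
  by rewrite /D big_mkcond /=; apply: eq_bigr => h _; rewrite /G; case: (q %| _)%N.
apply: le_trans (_ : \sum_(1 <= h < q) 2 * q%:R * (G h + G (q - h)%N) <= _); last first.
  rewrite -mulr_sumr big_split /= -GE.
  have -> : \sum_(1 <= h < q) G (q - h)%N = D.
    rewrite GE [RHS]big_nat_rev /=; apply: eq_big_nat => h /andP[h0 hq].
    by congr (G _); lia.
  by have -> : 2 * q%:R * (D + D) = 4 * D * q%:R by ring.
rewrite big_mkcond /=; apply: ler_sum_nat => h /andP[h0 hq].
have hq' : (0 < h < q)%N by rewrite h0.
have cq : (q %| (q - h) * u)%N = (q %| h * u)%N.
  have hqu : (h * u <= q * u)%N by rewrite leq_mul2r (ltnW hq) orbT.
  by rewrite mulnBl dvdn_subr// dvdn_mulr.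
rewrite /G cq; case: (boolP (q %| h * u)%N) => /= nq; first by rewrite addr0 mulr0.
rewrite recip_dist_rev// -mulrDr mulrA.
apply: le_trans; first exact: hit_mode_offdiag.
rewrite -[X in _ <= X * _]mulrA; apply: ler_wpM2l.
  by rewrite !mulr_ge0// recip_dist_ge0.
rewrite {1}/recip_dist modn_small// mulrDr natrB ?(ltnW hq)//.
have a0 : 0 <= A%:R :> R by [].
have x0 : 0 <= q%:R / h%:R :> R by rewrite divr_ge0.
have y0 : 0 <= q%:R / (q%:R - h%:R) :> R by rewrite divr_ge0// subr_ge0 ler_nat ltnW.
move: (A%:R) (_ / _) (q%:R / _) a0 x0 y0 => a x y a0 x0 y0.
by rewrite !minEle; do !case: ifPn; rewrite -?ltNge; lra.
Qed.

(** * Total contribution of the off-diagonal frequencies *)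

Definition harmonic_number (R : realType) (n : nat) : R :=
  \sum_(1 <= k < n.+1) k%:R^-1.

Lemma harmonic_number_ge0 (R : realType) (n : nat) : 0 <= harmonic_number R n.
Proof. by rewrite sumr_ge0. Qed.

Lemma sum_recip_dist_le (R : realType) (q : nat) :
  \sum_(1 <= m < q) recip_dist R q m <= 2 * harmonic_number R q.
Proof.
have [->|q0] := posnP q; first by rewrite big_geq// mulr_ge0// harmonic_number_ge0.
rewrite (eq_big_nat _ _ (F2 := fun m => m%:R^-1 + (q - m)%:R^-1)); last first.
  by move=> m /andP[_ mq]; rewrite /recip_dist modn_small.
have le1 : \sum_(1 <= m < q) m%:R^-1 <= harmonic_number R q.
  by rewrite /harmonic_number big_nat_recr//= lerDl.
rewrite big_split /= [X in _ + X](_ : _ = \sum_(1 <= m < q) m%:R^-1); first by lra.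
by rewrite big_nat_rev /=; apply: eq_big_nat => m /andP[m0 mq]; congr (_%:R^-1); lia.
Qed.

Lemma count_divisors_le (U N s : nat) : (0 < s)%N -> (s <= N)%N -> (U <= N)%N ->
  (\sum_(1 <= u < U.+1 | u %| s) 1 <= tau s)%N.
Proof.
move=> s0 sN UN; rewrite /tau -sum1_size (@sum_divisors _ s N)//.
by rewrite [leqRHS](big_cat_nat (n := U.+1))//= leq_addr.
Qed.

(* Grouping the pairs [(u, h)] by the product [s = h u = k q + m] makes the divisor
   function of [s] appear; the block [k = 0] contributes [A] and the block
   [k > 0] contributes [U / k]. *)
Lemma sum_offdiag_le (R : realType) (A q U : nat) (T : R) : (0 < q)%N ->
  0 <= T -> (forall s, (0 < s <= U * q)%N -> (tau s)%:R <= T) ->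
  \sum_(1 <= u < U.+1) \sum_(1 <= h < q | ~~ (q %| h * u)%N)
     recip_dist R q (h * u) * Num.min A%:R (q%:R / h%:R) <=
  2 * T * harmonic_number R q * (A%:R + U%:R * harmonic_number R U).
Proof.
move=> q0 T0 hT; have q0R : 0 < q%:R :> R by rewrite ltr0n.
have K0 n : 0 <= recip_dist R q n by rewrite addr_ge0.
(* For [s = h * u] with [u <= U] one has [q / h <= q * U / s], a bound depending on the product [s]
   alone. *)
pose W s : R := Num.min A%:R (q%:R * U%:R / s%:R).
pose G s : R := if (q %| s)%N then 0 else recip_dist R q s * W s.
have W0 s : 0 <= W s by rewrite le_min ler0n divr_ge0// mulr_ge0.
have G0 s : 0 <= G s by rewrite /G; case: ifP => // _; rewrite mulr_ge0.
have Gq s : (q %| s)%N -> G s = 0 by rewrite /G => ->.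
apply: le_trans (_ : \sum_(1 <= u < U.+1) \sum_(1 <= s < (U * q).+1 | (u %| s)%N) G s <= _).
  apply: ler_sum_nat => u /andP[u0 uU]; rewrite ltnS in uU.
  rewrite sum_multiples// [leRHS](big_cat_nat (n := q))//=; last first.
    by apply: leqW; rewrite leq_divRL// mulnC leq_mul2r uU orbT.
  apply: ler_wpDr; first by rewrite sumr_ge0.
  rewrite big_mkcond /=; apply: ler_sum_nat => h /andP[h0 hq].
  rewrite /G [(u * h)%N]mulnC; case: (boolP (q %| _)%N) => //= nq.
  apply: ler_wpM2l => //; rewrite /W le_min ge_min lexx /= ge_min.
  apply/orP; right; rewrite natrM invfM mulrACA mulrA.
  have h0R : 0 < h%:R :> R by rewrite ltr0n.
  have u0R : 0 < u%:R :> R by rewrite ltr0n.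
  rewrite -mulrA ler_peMr ?divr_ge0// ler_pdivlMr// mul1r ler_nat.
  by [].
rewrite (exchange_big_dep_nat predT) //=.
apply: le_trans (_ : \sum_(1 <= s < (U * q).+1) G s * T <= _).
  apply: ler_sum_nat => s /andP[s0 sU]; rewrite ltnS in sU.
  have -> : \sum_(1 <= u < U.+1 | (u %| s)%N) G s =
      G s * (\sum_(1 <= u < U.+1 | u %| s) 1)%N%:R.
    by rewrite natr_sum mulr_sumr; apply: eq_bigr => u _; rewrite mulr1.
  apply: ler_wpM2l => //; apply: le_trans (hT s _); last by rewrite s0.
  by rewrite ler_nat (@count_divisors_le U (U * q))// leq_pmulr.
rewrite -mulr_suml [leRHS](_ : _ =
  2 * harmonic_number R q * (A%:R + U%:R * harmonic_number R U) * T); last by ring.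
apply: ler_wpM2r => //.
(* [G] vanishes at both 0 and [U * q], so the range can be shifted to consist of [U] full blocks of
   length [q]. *)
have -> : \sum_(1 <= s < (U * q).+1) G s = \sum_(0 <= s < U * q) G s.
  rewrite -[LHS]add0r -{1}(Gq 0%N (dvdn0 q)) -big_ltn// big_nat_recr//=.
  by rewrite (Gq (U * q)%N (dvdn_mull _ (dvdnn q))) addr0.
rewrite big_nat_mul.
pose w i : R := if i == 0%N then A%:R else U%:R / i%:R.
have w0 i : 0 <= w i by rewrite /w; case: ifP => // _; rewrite divr_ge0.
apply: le_trans (_ : \sum_(0 <= i < U) 2 * harmonic_number R q * w i <= _).
  apply: ler_sum_nat => i _.
  rewrite -[X in \sum_(X <= _ < _) _]add0n big_addn mulSn addnK big_ltn//.
  rewrite add0n (Gq (i * q)%N (dvdn_mull _ (dvdnn q))) add0r.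
  apply: le_trans (_ : \sum_(1 <= m < q) recip_dist R q m * w i <= _).
    apply: ler_sum_nat => m /andP[m0 mq].
    have Km : recip_dist R q (m + i * q) = recip_dist R q m.
      by rewrite /recip_dist addnC modnMDl.
    rewrite /G; case: ifP => [_|nq]; first by rewrite mulr_ge0.
    rewrite Km; apply: ler_wpM2l => //; rewrite /W /w ge_min.
    have [//|i0] := eqVneq i 0%N; first by rewrite lexx.
    have i0R : 0 < i%:R :> R by rewrite ltr0n lt0n.
    apply/orP; right; rewrite ler_pdivrMr ?ltr0n ?addn_gt0 ?m0//.
    rewrite mulrAC ler_pdivlMr// natrD natrM.
    have : 0 <= U%:R * m%:R * i%:R :> R by rewrite !mulr_ge0.
    by rewrite mulrDr mulrA; nra.
  by rewrite -mulr_suml ler_wpM2r// sum_recip_dist_le.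
rewrite -mulr_sumr ler_wpM2l ?mulr_ge0 ?harmonic_number_ge0//.
case: (U) @w w0 => [|k] w w0.
  by rewrite big_geq// mul0r addr0.
rewrite big_ltn// {1}/w eqxx lerD2l /harmonic_number mulr_sumr.
rewrite [leRHS]big_nat_recr//=; apply: ler_wpDr; first by rewrite divr_ge0.
apply: ler_sum_nat => i /andP[i0 _].
by rewrite /w gtn_eqF.
Qed.

(** * The hyperbola method *)

(** A pair with product at most [X] cannot have both entries above [U], because [X < U.+1 * U.+1];
    the pairs with both entries at most [U] are counted twice and form a full square, because
    [U * U <= X]. *)
Lemma hyperbola_sum (R : realType) (f : nat -> R) (X U : nat) :
  (U * U <= X < U.+1 * U.+1)%N ->
  \sum_(1 <= n < X.+1) (tau n)%:R * f n =
  2 * (\sum_(1 <= u < U.+1) \sum_(1 <= v < (X %/ u).+1) f (u * v)%N)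
  - \sum_(1 <= u < U.+1) \sum_(1 <= v < U.+1) f (u * v)%N.
Proof.
move=> /andP[UX XU].
(* Extension by zero puts all three sums on the square of side [X], where they are compared term by
   term. *)
pose F u v : R := if (u * v <= X)%N then f (u * v)%N else 0.
have UleX : (U <= X)%N by apply: leq_trans UX; case: (U) => // k; rewrite leq_pmulr.
have row u : (0 < u)%N ->
    \sum_(1 <= v < (X %/ u).+1) f (u * v)%N = \sum_(1 <= v < X.+1) F u v.
  move=> u0; rewrite (@big_nat_widen _ _ _ _ _ X.+1) ?ltnS ?leq_div//= big_mkcond /=.
  by apply: eq_bigr => v _; rewrite /F ltnS leq_divRL// mulnC.
have -> : \sum_(1 <= n < X.+1) (tau n)%:R * f n =
    \sum_(1 <= u < X.+1) \sum_(1 <= v < X.+1) F u v.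
  transitivity (\sum_(1 <= n < X.+1) \sum_(1 <= u < X.+1 | (u %| n)%N) f n).
    apply: eq_big_nat => n /andP[n0 nX]; rewrite ltnS in nX.
    rewrite -(sum_divisors (fun=> f n) n0 nX) big_const_seq count_predT.
    by rewrite iter_addr_0 mulr_natl.
  rewrite (exchange_big_dep_nat predT) //=.
  by apply: eq_big_nat => u /andP[u0 _]; rewrite sum_multiples// row.
have -> : \sum_(1 <= u < U.+1) \sum_(1 <= v < (X %/ u).+1) f (u * v)%N =
    \sum_(1 <= u < X.+1) \sum_(1 <= v < X.+1) (if (u <= U)%N then F u v else 0).
  rewrite (@big_nat_widen _ _ _ _ _ X.+1)//= big_mkcond /=.
  apply: eq_big_nat => u /andP[u0 _]; rewrite ltnS.
  by case: ifP => _; [rewrite row|rewrite big1].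
have -> : \sum_(1 <= u < U.+1) \sum_(1 <= v < U.+1) f (u * v)%N =
    \sum_(1 <= u < X.+1) \sum_(1 <= v < X.+1)
      (if (u <= U)%N && (v <= U)%N then F u v else 0).
  rewrite (@big_nat_widen _ _ _ _ _ X.+1)//= big_mkcond /=.
  apply: eq_big_nat => u /andP[u0 _]; rewrite ltnS.
  case: ifP => uU /=; last by rewrite big1.
  rewrite (@big_nat_widen _ _ _ _ _ X.+1)//= big_mkcond /=.
  apply: eq_bigr => v _; rewrite ltnS; case: ifP => // vU.
  by rewrite /F (leq_trans (leq_mul uU vU) UX).
rewrite mulr2n mulrDl mul1r [X in _ = _ + X - _]exchange_big_nat /= -sumrN -!big_split /=.
apply: eq_bigr => u _; rewrite -sumrN -!big_split /=; apply: eq_bigr => v _.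
rewrite /F [(v * u)%N]mulnC; case: (leqP u U) => uU; case: (leqP v U) => vU /=.
- by rewrite addrK.
- by rewrite addr0 subr0.
- by rewrite add0r subr0.
- rewrite !addr0 subr0 ifF//; apply/negbTE; rewrite -ltnNge.
  exact: leq_trans XU (leq_mul uU vU).
Qed.

(** * Ramanujan sums over an interval *)

Lemma count_interval_multiples (A e : nat) (B : int) : (0 < e)%N ->
  (e * \sum_(1 <= i < A.+1 | (e%:Z %| (B + i%:Z)%R)%Z) 1 <= A + e)%N.
Proof.
(* Replacing [B] by its residue [b < e] moves the count to natural numbers at most [A + b]. *)
move=> e0; pose b := `|(B %% e)%Z|%N.
have bE : b%:Z = (B %% e)%Z by rewrite /b gez0_abs// modz_ge0//; lia.
have be : (b < e)%N by have := ltz_pmod B (_ : 0 < e%:Z); rewrite -bE; lia.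
have cond i : (e%:Z %| B + i%:Z)%Z = (e %| i + b)%N.
  rewrite [in LHS](divz_eq B e) -bE -addrA rpredDl ?dvdz_mull//.
  by rewrite -PoszD addnC.
under eq_bigl do rewrite cond.
have -> : (\sum_(1 <= i < A.+1 | e %| i + b) 1 =
           \sum_(1 + b <= n < (A + b).+1 | e %| n) 1)%N.
  by rewrite big_addn -addSn addnK.
apply: leq_trans (_ : e * ((A + b) %/ e) <= _)%N; last first.
  by rewrite mulnC (leq_trans (leq_trunc_div _ _))// leq_add2l ltnW.
rewrite leq_mul2l -count_multiples//; apply/orP; right.
rewrite [leqRHS](big_cat_nat (n := 1 + b)%N)//=; last by lia.
by rewrite leq_addl.
Qed.

Lemma gcd_weight_bounds (R : realType) (A q : nat) (B : int) (u : nat) :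
  (0 < q)%N -> 0 <= gcd_weight R A q B u <= (A + q)%:R.
Proof.
move=> q0; have g0 : (0 < gcdn u q)%N by rewrite gcdn_gt0 q0 orbT.
rewrite sumr_ge0 => [|i _]; last by case: ifP.
rewrite /gcd_weight -big_mkcond /= (_ : \sum_(_ <= _ < _ | _) _ =
   (gcdn u q * \sum_(1 <= i < A.+1 | ((gcdn u q)%:Z %| (B + i%:Z)%R)%Z) 1)%N%:R).
  rewrite ler_nat (leq_trans (count_interval_multiples _ _ g0))// leq_add2l.
  by rewrite dvdn_leq// dvdn_gcdr.
by rewrite natrM natr_sum mulr_sumr; apply: eq_bigr => i _; rewrite mulr1.
Qed.

Definition ramanujan_interval_sum (R : realType) (A : nat) (B : int) (d : nat) : R :=
  \sum_(1 <= i < A.+1) (ramanujan_sum d (B + i%:Z))%:~R.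

(** Each divisor [e] of [d] contributes at most [e] times the number of its multiples in the
    interval, hence at most [A + e]. *)
Lemma norm_ramanujan_interval_sum_le (R : realType) (A d : nat) (B : int) :
  (0 < d)%N -> `|ramanujan_interval_sum R A B d| <= (tau d * (A + d))%:R.
Proof.
move=> d0; apply: le_trans (ler_norm_sum _ _ _) _.
apply: le_trans (_ : \sum_(1 <= i < A.+1) \sum_(1 <= e < d.+1 | (e%:Z %| B + i%:Z)%Z && (e %| d)%N) e%:R <= _).
  apply: ler_sum => i _.
  rewrite -intr_norm /ramanujan_sum (@sum_divisors _ _ d) ?gcdn_gt0 ?d0 ?orbT//; last first.
    by rewrite dvdn_leq// dvdn_gcdr.
  under eq_bigl do rewrite dvdn_gcd_absz.
  apply: le_trans (_ : (\sum_(1 <= e < d.+1 | (e%:Z %| B + i%:Z)%Z && (e %| d)%N) e%:Z)%:~R <= _).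
    rewrite ler_int; apply: le_trans (ler_norm_sum _ _ _) _.
    apply: ler_sum => e _; rewrite normrM.
    by rewrite -[leRHS]mulr1 ler_pM// normr_moebius_le1.
  by rewrite rmorph_sum /=; apply: ler_sum => e _; rewrite -pmulrn.
rewrite (exchange_big_dep_nat (fun e => e %| d)%N) /=; last first.
  by move=> i e _ _ _ /andP[].
rewrite natrM /tau -sum1_size natr_sum mulr_suml (@sum_divisors _ d d)//.
rewrite big_nat_cond [leRHS]big_nat_cond; apply: ler_sum => e /andP[/andP[e0 ed] edvd].
rewrite mul1r; under eq_bigl do rewrite edvd andbT.
apply: le_trans (_ : (e * \sum_(1 <= i < A.+1 | (e%:Z %| (B + i%:Z)%R)%Z) 1)%N%:R <= _).
  by rewrite natrM natr_sum mulr_sumr; apply: ler_sum => i _; rewrite mulr1.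
by rewrite ler_nat (leq_trans (count_interval_multiples _ _ e0))// leq_add2l.
Qed.

(** This is [sum_ramanujan] at [gcdn u q], summed over the interval; it brings in the Ramanujan sums
    of [main_poly]. *)
Lemma gcd_weight_ramanujan (R : realType) (A q : nat) (B : int) (u : nat) :
  (0 < q)%N -> gcd_weight R A q B u =
  \sum_(1 <= d < q.+1 | (d %| q)%N && (d %| u)%N) ramanujan_interval_sum R A B d.
Proof.
move=> q0; have g0 : (0 < gcdn u q)%N by rewrite gcdn_gt0 q0 orbT.
rewrite exchange_big /=; apply: eq_bigr => i _.
under [RHS]eq_bigl do rewrite andbC -dvdn_gcd.
rewrite -(@sum_divisors _ _ q)//; last by rewrite dvdn_leq// dvdn_gcdr.
rewrite -rmorph_sum /= sum_ramanujan//.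
by case: ifP => _; rewrite ?rmorph0 -?pmulrn.
Qed.

Lemma sum_gcd_weight (R : realType) (A q U : nat) (B : int) (F : nat -> R) :
  (0 < q)%N ->
  \sum_(1 <= u < U.+1) F u * gcd_weight R A q B u =
  \sum_(d <- divisors q) ramanujan_interval_sum R A B d *
    \sum_(1 <= m < (U %/ d).+1) F (d * m)%N.
Proof.
move=> q0; rewrite (@sum_divisors _ q q)//.
transitivity (\sum_(1 <= u < U.+1)
   \sum_(1 <= d < q.+1 | (d %| q)%N && (d %| u)%N) F u * ramanujan_interval_sum R A B d).
  by apply: eq_bigr => u _; rewrite gcd_weight_ramanujan// mulr_sumr.
rewrite (exchange_big_dep_nat (fun d => d %| q)%N) /=; last by move=> u d _ _ _ /andP[].
rewrite big_nat_cond [RHS]big_nat_cond.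
apply: eq_bigr => d /andP[/andP[d0 _] dq]; rewrite dq /= mulr_sumr sum_multiples//.
by apply: eq_bigr => m _; rewrite mulrC.
Qed.

(** * Harmonic sums, Euler's constant and the main term *)

Lemma ln_succ_bounds (R : realType) (x : R) : 0 < x ->
  (x + 1)^-1 <= ln (x + 1) - ln x <= x^-1.
Proof.
move=> x0; have x10 : 0 < x + 1 by rewrite addr_gt0.
apply/andP; split.
  rewrite -lerN2 opprB -ln_div ?posrE//.
  have -> : x / (x + 1) = 1 + - (x + 1)^-1 by field; rewrite gt_eqF.
  by apply: le_ln1Dx; rewrite ltrN2 invf_lt1// ltrDr.
rewrite -ln_div ?posrE//.
have -> : (x + 1) / x = 1 + x^-1 by field; rewrite gt_eqF.
by apply: le_ln1Dx; rewrite (lt_trans (ltrN10 R)) ?invr_gt0.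
Qed.

(** The step from [k] to [k + 1] changes [gamma_seq] by an amount between [(k + 1)^-1 - k^-1] and 0,
    and these lower bounds telescope. *)
Lemma gamma_seq_between (R : realType) (n j : nat) : (0 < n)%N ->
  @gamma_seq R n - n%:R^-1 + (n + j)%:R^-1 <= @gamma_seq R (n + j) <= @gamma_seq R n.
Proof.
move=> n0; elim: j => [|j /andP[IH1 IH2]]; first by rewrite addn0 subrK lexx.
have k0 : 0 < (n + j)%:R :> R by rewrite ltr0n addn_gt0 n0.
have /andP[] := ln_succ_bounds k0; rewrite addnS.
have -> : gamma_seq (n + j).+1 = gamma_seq (n + j) + (n + j).+1%:R^-1
     - (ln (n + j).+1%:R - ln (n + j)%:R) :> R.
  by rewrite /gamma_seq big_nat_recr//=; ring.
rewrite natr1; move: IH1 IH2.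
move: (gamma_seq (n + j)) (gamma_seq n) ((n + j).+1%:R^-1) ((n + j)%:R^-1) (n%:R^-1).
move: (ln _) (ln _) => *; apply/andP; split; lra.
Qed.

Lemma gamma_seq_sub_euler_gamma (R : realType) (n : nat) : (0 < n)%N ->
  0 <= @gamma_seq R n - euler_gamma <= n%:R^-1.
Proof.
move=> n0; have cv := @gamma_seq_cvg R.
have hi : euler_gamma <= gamma_seq n :> R.
  apply: limr_le => //; near=> k.
  have nk : (n <= k)%N by near: k; exact: nbhs_infty_ge.
  by have /andP[_] := gamma_seq_between R (k - n) n0; rewrite subnKC.
have lo : gamma_seq n - n%:R^-1 <= euler_gamma :> R.
  apply: limr_ge => //; near=> k.
  have nk : (n <= k)%N by near: k; exact: nbhs_infty_ge.
  have /andP[+ _] := gamma_seq_between R (k - n) n0; rewrite subnKC//.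
  by apply: le_trans; rewrite lerDl invr_ge0.
by apply/andP; split; lra.
Unshelve. all: by end_near.
Qed.

Lemma euler_gamma_bounds (R : realType) : 0 <= @euler_gamma R <= 1.
Proof.
have /andP[] := @gamma_seq_sub_euler_gamma R 1 isT.
by rewrite /gamma_seq big_nat1 ln1 invr1; lra.
Qed.

Lemma harmonic_number_le_ln (R : realType) (n : nat) : (0 < n)%N ->
  harmonic_number R n <= 1 + ln n%:R.
Proof.
move=> n0; have /andP[_] := gamma_seq_sub_euler_gamma R n0.
have /andP[_] := @gamma_seq_between R 1 n.-1 isT; rewrite add1n prednK//.
by rewrite /gamma_seq big_nat1 ln1 invr1 -/(harmonic_number R n); lra.
Qed.

Lemma harmonic_number_log (R : realType) (d U X : nat) :
  (0 < d)%N -> (0 < U)%N -> (U * U <= X < U.+1 * U.+1)%N ->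
  `|2 * harmonic_number R (U %/ d) - (ln X%:R - 2 * ln d%:R + 2 * euler_gamma)| <=
  4 * (d%:R / U%:R).
Proof.
move=> d0 U0 /andP[UX XU].
have d0R : 0 < d%:R :> R by rewrite ltr0n.
have U0R : 0 < U%:R :> R by rewrite ltr0n.
have X0R : 0 < X%:R :> R by rewrite ltr0n (leq_trans _ UX)// muln_gt0 U0.
have /andP[g0 g1] := euler_gamma_bounds R.
have lnsq k : (0 < k)%N -> ln (k * k)%:R = 2 * ln k%:R :> R.
  by move=> k0; rewrite natrM lnM ?posrE ?ltr0n//; ring.
have lnU : 2 * ln U%:R <= ln X%:R :> R.
  by rewrite -lnsq// ler_ln ?posrE ?X0R ?ltr0n ?muln_gt0 ?U0// ler_nat.
have lnUS : ln X%:R <= 2 * ln U.+1%:R :> R.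
  by rewrite -lnsq// ler_ln ?posrE ?X0R ?ltr0n// ler_nat ltnW.
have Ud : (U.+1 <= d * (U %/ d).+1)%N by rewrite mulnC ltn_ceil.
have dU : (d * (U %/ d) <= U)%N by rewrite mulnC leq_trunc_div.
set m := (U %/ d)%N in Ud dU *.
have lnUd : ln U.+1%:R <= ln d%:R + ln m.+1%:R :> R.
  by rewrite -lnM ?posrE ?ltr0n// -natrM ler_ln ?posrE ?X0R ?ltr0n ?muln_gt0 ?d0// ler_nat.
(* For [d > U] the harmonic sum is empty, and the logarithmic expression is itself bounded by a
   multiple of [d / U]. *)
have [m0|m0] := posnP m.
  rewrite m0 in Ud lnUd *; rewrite ln1 addr0 in lnUd.
  rewrite /harmonic_number big_geq// mulr0 sub0r normrN.
  have Udd : U%:R <= d%:R :> R by rewrite ler_nat ltnW// -[d]muln1.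
  have one : 1 <= d%:R / U%:R :> R by rewrite ler_pdivlMr// mul1r.
  have := ln_sublinear (divr_gt0 d0R U0R); rewrite ln_div ?posrE// => lnle.
  by rewrite ler_norml; apply/andP; split; lra.
have m0R : 0 < m%:R :> R by rewrite ltr0n.
have /andP[h0 h1] := gamma_seq_sub_euler_gamma R m0.
have /andP[_] := ln_succ_bounds m0R; rewrite natr1 => lnS.
have lnm : ln d%:R + ln m%:R <= ln U%:R :> R.
  by rewrite -lnM ?posrE// -natrM ler_ln ?posrE ?X0R ?ltr0n ?muln_gt0 ?d0// ler_nat.
(* This follows from [U < d * (m + 1) <= 2 * d * m]. *)
have minv : m%:R^-1 <= 2 * (d%:R / U%:R) :> R.
  rewrite mulrA ler_pdivlMr// mulrC ler_pdivrMr// -!natrM ler_nat.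
  by move: Ud m0; move: (m) => k; nia.
have hE : harmonic_number R m = gamma_seq m + ln m%:R by rewrite /gamma_seq subrK.
by rewrite hE ler_norml; apply/andP; split; lra.
Qed.

(** The harmonic sum yields the logarithm and Euler's constant, while the subtracted square, close
    to [X / d], yields the [- 1] of [main_poly]. The constant is 16 + 3. *)
Lemma main_term_divisor_le (R : realType) (d U X : nat) :
  (0 < d)%N -> (0 < U)%N -> (U * U <= X < U.+1 * U.+1)%N ->
  `|2 * (X%:R / d%:R * harmonic_number R (U %/ d)) - U%:R * (U %/ d)%:R
    - X%:R / d%:R * (ln X%:R - 2 * ln d%:R + 2 * euler_gamma - 1)| <= 19 * U%:R.
Proof.
move=> d0 U0 hX; have hl := harmonic_number_log R d0 U0 hX.
move/andP: hX => [UX XU].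
have d0R : 0 < d%:R :> R by rewrite ltr0n.
have U0R : 0 < U%:R :> R by rewrite ltr0n.
have Ud : (U.+1 <= d * (U %/ d).+1)%N by rewrite mulnC ltn_ceil.
have dU : (d * (U %/ d) <= U)%N by rewrite mulnC leq_trunc_div.
set m := (U %/ d)%N in Ud dU hl *.
set H := harmonic_number R m in hl *.
set L := ln X%:R - 2 * ln d%:R + 2 * euler_gamma in hl *.
have -> : 2 * (X%:R / d%:R * H) - U%:R * m%:R - X%:R / d%:R * (L - 1) =
   X%:R / d%:R * (2 * H - L) + (X%:R / d%:R - U%:R * m%:R) by ring.
apply: le_trans (ler_normD _ _) _.
have Xd0 : 0 <= X%:R / d%:R :> R by rewrite divr_ge0.
have hX4 : X%:R <= 4 * (U%:R * U%:R) :> R.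
  by rewrite -!natrM ler_nat; nia.
(* The error [4 * d / U] times [X / d], with [X <= 4 * U ^ 2]. *)
have t1 : `|X%:R / d%:R * (2 * H - L)| <= 16 * U%:R.
  rewrite normrM ger0_norm//; apply: le_trans (ler_wpM2l Xd0 hl) _.
  have -> : X%:R / d%:R * (4 * (d%:R / U%:R)) = 4 * X%:R / U%:R :> R.
    by field; rewrite !gt_eqF.
  by rewrite ler_pdivrMr//; lra.
have t2 : `|X%:R / d%:R - U%:R * m%:R| <= 3 * U%:R :> R.
  have -> : X%:R / d%:R - U%:R * m%:R = (X%:R - U%:R * m%:R * d%:R) / d%:R :> R.
    by field; rewrite gt_eqF.
  have e0 : 0 <= X%:R - U%:R * m%:R * d%:R :> R.
    by rewrite subr_ge0 -!natrM ler_nat; nia.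
  rewrite ger0_norm ?divr_ge0// ler_pdivrMr// lerBlDr -!natrM -natrD ler_nat.
  by nia.
by lra.
Qed.

(** * Assembling the error sum over the interval *)

Lemma error_sum_interval (R : realType) (A X q : nat) (B : int) :
  error_sum X (int_interval B A) q =
  \sum_(1 <= i < A.+1) remainder X (B + i%:Z) q :> R.
Proof.
rewrite /error_sum /index_iota subn1 /= -[RHS](big_map (fun i : nat => B + i%:Z) predT (fun a => remainder X a q)).
apply: perm_big; apply: uniq_perm.
- exact: fset_uniq.
- by rewrite map_inj_uniq ?iota_uniq// => i j /addrI [].
- move=> a; apply/imfsetP/mapP => -[i]; rewrite ?inE => iI ->; by exists i.
Qed.

Lemma sum_divisor_sum (R : realType) (A X q : nat) (B : int) :
  \sum_(1 <= i < A.+1) (divisor_sum X (B + i%:Z) q)%:R =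
  \sum_(1 <= n < X.+1) (tau n)%:R * interval_hits R A q B n.
Proof.
transitivity (\sum_(1 <= i < A.+1) \sum_(1 <= n < X.+1)
    (tau n)%:R * (n%:Z == B + i%:Z %[mod q%:Z])%Z%:R : R).
  apply: eq_bigr => i _; rewrite /divisor_sum natr_sum big_mkcond /=.
  by apply: eq_bigr => n _; case: ifP; rewrite ?mulr1 ?mulr0.
by rewrite exchange_big /=; apply: eq_bigr => n _; rewrite mulr_sumr.
Qed.

Lemma sum_main_term (R : realType) (A X q : nat) (B : int) :
  \sum_(1 <= i < A.+1) main_term X (B + i%:Z) q =
  q%:R^-1 * \sum_(d <- divisors q) ramanujan_interval_sum R A B d *
    (X%:R / d%:R * (ln X%:R - 2 * ln d%:R + 2 * euler_gamma - 1)).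
Proof.
rewrite /main_term /main_poly -mulr_sumr exchange_big /= !mulr_sumr.
apply: eq_bigr => d _; rewrite -!mulr_suml /ramanujan_interval_sum; ring.
Qed.

(** The explicit form of the estimate: every divisor function that occurs has its argument at most
    [U * q], so one bound [T] serves throughout. *)
Lemma norm_error_sum_le (R : realType) (A X q U : nat) (B : int) (T : R) :
  (0 < U)%N -> (U * U <= X < U.+1 * U.+1)%N -> (0 < q)%N -> (A <= q)%N ->
  (forall s, (0 < s <= U * q)%N -> (tau s)%:R <= T) ->
  `|error_sum X (int_interval B A) q : R| <=
  24 * T * harmonic_number R q * (A%:R + U%:R * harmonic_number R U)
  + 4 * U%:R + 38 * U%:R * T ^+ 2.
Proof.
move=> U0 hX q0 Aq hT.
have q0R : 0 < q%:R :> R by rewrite ltr0n.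
have T0 : 0 <= T by apply: le_trans (hT 1%N _) => //; rewrite muln_gt0 U0.
rewrite error_sum_interval /remainder big_split /= sumrN sum_divisor_sum sum_main_term.
rewrite (hyperbola_sum _ hX).
pose N u Y : R := \sum_(1 <= v < Y.+1) interval_hits R A q B (u * v).
pose g u : R := gcd_weight R A q B u.
pose del u : R := 4 * \sum_(1 <= h < q | ~~ (q %| h * u)%N)
        recip_dist R q (h * u) * Num.min A%:R (q%:R / h%:R).
have hN u Y : `|N u Y - Y%:R / q%:R * g u| <= del u by exact: hits_discrepancy.
have g_le u : 0 <= g u / q%:R <= 2.
  have /andP[g0 g1] := gcd_weight_bounds R A B u q0.
  rewrite divr_ge0//= ler_pdivrMr//; apply: le_trans g1 _.
  by rewrite -natrM ler_nat; lia.
pose rho d : R := ramanujan_interval_sum R A B d.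
(* [P1 / q] is the hyperbola sum with each count replaced by its expected value and the floor of
   [X / u] by [X / u]. *)
pose P1 : R := \sum_(1 <= u < U.+1) (2 * (X%:R / u%:R) - U%:R) * g u.
(* The long count enters twice and the square count once, giving [3 * del u]; removing the floor
   costs at most 2 times the density bound 2. *)
have step1 : `|2 * (\sum_(1 <= u < U.+1) \sum_(1 <= v < (X %/ u).+1) interval_hits R A q B (u * v))
    - \sum_(1 <= u < U.+1) \sum_(1 <= v < U.+1) interval_hits R A q B (u * v)
    - q%:R^-1 * P1| <= \sum_(1 <= u < U.+1) (3 * del u + 4).
  rewrite /P1 !mulr_sumr -!sumrN -!big_split /=.
  apply: le_trans (ler_norm_sum _ _ _) _; apply: ler_sum_nat => u /andP[u0 uU].
  rewrite -/(N u (X %/ u)%N) -/(N u U).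
  have u0R : 0 < u%:R :> R by rewrite ltr0n.
  have fl0 : (X %/ u)%:R <= X%:R / u%:R :> R.
    by rewrite ler_pdivlMr// -natrM ler_nat leq_trunc_div.
  have fl1 : X%:R / u%:R <= (X %/ u)%:R + 1 :> R.
    by rewrite ler_pdivrMr// natr1 -natrM ler_nat ltnW// ltn_ceil.
  have h1 := hN u (X %/ u)%N; have h2 := hN u U.
  have /andP[gu0 gu2] := g_le u.
  have -> : 2 * N u (X %/ u)%N - N u U - q%:R^-1 * ((2 * (X%:R / u%:R) - U%:R) * g u) =
     2 * (N u (X %/ u)%N - (X %/ u)%:R / q%:R * g u) - (N u U - U%:R / q%:R * g u)
     - 2 * ((X%:R / u%:R - (X %/ u)%:R) * (g u / q%:R)) by ring.
  move: h1 h2; set a := N u _ - _; set b := N u _ - _.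
  rewrite !ler_norml => /andP[a1 a2] /andP[b1 b2].
  set t := X%:R / u%:R - _; set y := g u / _ in gu0 gu2 *.
  have t0 : 0 <= t by rewrite subr_ge0.
  have t1 : t <= 1 by rewrite lerBlDl.
  have ty0 : 0 <= t * y by rewrite mulr_ge0.
  have ty2 : t * y <= 2 by nra.
  by apply/andP; split; lra.
(* At most [T] divisors [d] occur, each with Ramanujan part at most [T * (2 * q)] and discrepancy at
   most [19 * U]. *)
have step2 : `|q%:R^-1 * P1 - q%:R^-1 * \sum_(d <- divisors q) rho d *
    (X%:R / d%:R * (ln X%:R - 2 * ln d%:R + 2 * euler_gamma - 1))| <= 38 * U%:R * T ^+ 2.
  rewrite /P1 sum_gcd_weight// -mulrBr -sumrB normrM gtr0_norm ?invr_gt0// mulrC.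
  rewrite ler_pdivrMr//; apply: le_trans (ler_norm_sum _ _ _) _.
  apply: le_trans (_ : \sum_(d <- divisors q) (T * (2 * q%:R)) * (19 * U%:R) <= _); last first.
    rewrite big_const_seq count_predT iter_addr_0 -[leLHS]mulr_natl.
    have := hT q; rewrite q0 leq_pmull// => /(_ isT) hq.
    rewrite -/(tau q).
    have -> : 38 * U%:R * T ^+ 2 * q%:R = T * (T * (2 * q%:R) * (19 * U%:R)) by ring.
    by apply: ler_wpM2r => //; rewrite !mulr_ge0.
  rewrite big_seq [leRHS]big_seq; apply: ler_sum => d; rewrite -dvdn_divisors// => dq.
  have d0 : (0 < d)%N by apply: dvdn_gt0 dq.
  have dleq : (d <= q)%N by apply: dvdn_leq.
  have d0R : 0 < d%:R :> R by rewrite ltr0n.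
  rewrite -mulrBr normrM; apply: ler_pM => //.
    apply: le_trans (norm_ramanujan_interval_sum_le _ _ _ d0) _.
    rewrite natrM; apply: ler_pM => //.
      by apply: hT; rewrite d0 (leq_trans dleq)// leq_pmull.
    by rewrite -natrM ler_nat; lia.
  have -> : \sum_(1 <= m < (U %/ d).+1) (2 * (X%:R / (d * m)%:R) - U%:R) =
      2 * (X%:R / d%:R * harmonic_number R (U %/ d)) - U%:R * (U %/ d)%:R.
    rewrite sumrB sumr_const_nat subn1 /= mulr_natr; congr (_ - _).
    rewrite /harmonic_number !mulr_sumr; apply: eq_bigr => m _.
    by rewrite natrM invfM !mulrA.
  exact: main_term_divisor_le.
(* Here 24 is 3 times the 4 of [hits_discrepancy] times the 2 of [sum_offdiag_le]. *)
have step3 : \sum_(1 <= u < U.+1) (3 * del u + 4) <=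
    24 * T * harmonic_number R q * (A%:R + U%:R * harmonic_number R U) + 4 * U%:R.
  rewrite big_split /= sumr_const_nat subn1 /= -[4 *+ U]mulr_natr lerD2r /del -!mulr_sumr.
  have := sum_offdiag_le A q0 T0 hT; lra.
move: step1 step2 step3; rewrite /rho.
set a := 2 * _ - _; set b := q%:R^-1 * P1; set c := q%:R^-1 * _.
move=> s1 s2 s3; rewrite -[a - c](subrKA b).
apply: le_trans (ler_normD _ _) _.
by apply: lerD => //; apply: le_trans s1 s3.
Qed.

(** * Absorbing logarithms and divisor functions into a power of q *)

Lemma harmonic_number_le_powR (R : realType) (del : R) (n : nat) : 0 < del ->
  (0 < n)%N -> harmonic_number R n <= (1 + del^-1) * n%:R `^ del.
Proof.
move=> del0 n0; apply: le_trans (harmonic_number_le_ln _ n0) _.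
have n0R : 0 < n%:R :> R by rewrite ltr0n.
have p1 : 1 <= n%:R `^ del.
  by rewrite -[leLHS](powRr0 n%:R) ler_powR ?ler1n// ltW.
have : del * ln n%:R <= n%:R `^ del.
  by rewrite -ln_powR ltW// ln_sublinear// powR_gt0.
rewrite mulrC -ler_pdivlMr// mulrDl mul1r [_^-1 * _]mulrC; lra.
Qed.

Lemma isqrt_exists (X : nat) : exists U, (U * U <= X < U.+1 * U.+1)%N.
Proof.
elim: X => [|X [U /andP[h1 h2]]]; first by exists 0%N.
have [h|h] := leqP (U.+1 * U.+1) X.+1; last by exists U; rewrite h leqW.
by exists U.+1; rewrite h /=; nia.
Qed.

Theorem theorem1p2 (R : realType) (eps : R) (eps_gt0 : 0 < eps) :
  exists C : R, forall (A X q : nat) (B : int),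
    (2 <= q)%N -> (A <= q)%N -> (q <= X)%N ->
    X%:R `^ (19 / 31) <= q%:R :> R ->
    `| error_sum X (int_interval B A) q | <=
      (A%:R * X%:R `^ (1 / 2) * q%:R `^ (- (1 / 2))
       + A%:R `^ (1 / 8) * X%:R `^ (1 / 4) * q%:R `^ (1 / 2)
       + A%:R `^ (1 / 2) * X%:R `^ (1 / 4) * q%:R `^ (1 / 4))
      * (C * q%:R `^ eps).
Proof.
(* Four factors [q ^ del] are spent: two on the divisor bound up to [U * q <= q ^ 2] and two on the
   harmonic numbers, or all four on the squared divisor bound. *)
pose del := eps / 4; have del0 : 0 < del by rewrite divr_gt0.
have [C1 C11 tauC1] := divisor_bound del0.
pose C2 : R := 1 + del^-1.
have C21 : 1 <= C2 by rewrite lerDl invr_ge0 ltW.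
exists (24 * C1 * C2 * C2 + 4 + 38 * C1 ^+ 2) => A X q B q2 Aq qX Xq.
have q0 : (0 < q)%N by lia.
have X0 : (0 < X)%N by lia.
have q1R : 1 <= q%:R :> R by rewrite ler1n.
have X1R : 1 <= X%:R :> R by rewrite ler1n.
have q0R := lt_le_trans ltr01 q1R.
have X0R := lt_le_trans ltr01 X1R.
set Rhs := (X in X * _).
have Rhs0 : 0 <= Rhs by rewrite !addr_ge0// !mulr_ge0// powR_ge0.
(* The empty interval is treated apart, since [1 <= A ^ (1 / 8)] is used at the end. *)
have [A0|A0] := posnP A.
  rewrite A0 error_sum_interval big_geq// normr0 mulr_ge0// mulr_ge0 ?powR_ge0//.
  by rewrite !addr_ge0// ?mulr_ge0 ?exprn_ge0//; lra.
have [U hX] := isqrt_exists X; have /andP[UX XU] := hX.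
have U0 : (0 < U)%N by rewrite lt0n; apply: contraTneq XU => ->; rewrite -leqNgt.
have U0R : 0 < U%:R :> R by rewrite ltr0n.
have UsqX : U%:R <= X%:R `^ (1 / 2) :> R.
  have -> : U%:R = (U%:R ^+ 2) `^ (1 / 2) :> R.
    by rewrite -powR_mulrn// -powRrM (_ : 2%:R * (1 / 2) = 1) ?powRr1//; field.
  apply: ge0_ler_powR; rewrite ?nnegrE ?exprn_ge0//.
  by rewrite expr2 -natrM ler_nat.
(* The lower bound on [q] enters here, through 1/2 < 19/31. *)
have Xhq : X%:R `^ (1 / 2) <= q%:R :> R.
  by apply: le_trans Xq; rewrite ler_powR//; lra.
have Uq : (U <= q)%N by rewrite -(ler_nat R) (le_trans UsqX).
pose Q := q%:R `^ del.
have Q1 : 1 <= Q by rewrite -[leLHS](powRr0 q%:R) ler_powR// ltW.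
have Q4 : q%:R `^ eps = Q ^+ 4.
  by rewrite -powR_mulrn ?powR_ge0// -powRrM; congr (_ `^ _); rewrite /del; field.
have hT s : (0 < s <= U * q)%N -> (tau s)%:R <= C1 * Q ^+ 2.
  move=> /andP[s0 sUq]; apply: le_trans (tauC1 _ s0) _.
  rewrite ler_pM2l ?(lt_le_trans ltr01)// expr2 -powRM ?(ltW q0R)//.
  apply: ge0_ler_powR; rewrite ?(ltW del0) ?nnegrE ?mulr_ge0 ?(ltW q0R)//.
  by rewrite -natrM ler_nat (leq_trans sUq)// leq_mul2r Uq orbT.
have hq : harmonic_number R q <= C2 * Q by exact: harmonic_number_le_powR.
have hU : harmonic_number R U <= C2 * Q.
  apply: le_trans hq; rewrite /harmonic_number.
  rewrite [leRHS](big_cat_nat (n := U.+1))//=; apply: ler_wpDr => //.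
  by rewrite sumr_ge0.
have A0R : 0 <= A%:R :> R by [].
have key : `|error_sum X (int_interval B A) q : R| <=
    (A%:R + U%:R) * ((24 * C1 * C2 * C2 + 4 + 38 * C1 ^+ 2) * q%:R `^ eps).
  apply: le_trans (norm_error_sum_le B U0 hX q0 Aq hT) _; rewrite Q4.
  have Q0 : 0 <= Q by lra.
  have H1 : A%:R + U%:R * harmonic_number R U <= (A%:R + U%:R) * (C2 * Q).
    have C2Q : 1 <= C2 * Q by nra.
    rewrite mulrDl; apply: lerD; last by rewrite ler_pM2l.
    by rewrite ler_peMr.
  have C10 : 0 <= C1 by lra.
  have Q20 : 0 <= Q ^+ 2 by rewrite exprn_ge0.
  have t1 : 24 * (C1 * Q ^+ 2) * harmonic_number R q *
      (A%:R + U%:R * harmonic_number R U) <=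
      24 * (C1 * Q ^+ 2) * (C2 * Q) * ((A%:R + U%:R) * (C2 * Q)).
    apply: ler_pM => //.
    - by rewrite !mulr_ge0// harmonic_number_ge0.
    - by rewrite addr_ge0// mulr_ge0// harmonic_number_ge0.
    - by rewrite ler_wpM2l// !mulr_ge0.
  have t2 : 4 * U%:R <= (A%:R + U%:R) * (4 * Q ^+ 4).
    have : 1 <= Q ^+ 4 by rewrite exprn_ege1.
    by move=> h; rewrite mulrCA ler_pM2l// -[leLHS]mulr1 ler_pM// lerDr.
  have t3 : 38 * U%:R * (C1 * Q ^+ 2) ^+ 2 <= (A%:R + U%:R) * (38 * C1 ^+ 2 * Q ^+ 4).
    have -> : 38 * U%:R * (C1 * Q ^+ 2) ^+ 2 = U%:R * (38 * C1 ^+ 2 * Q ^+ 4) by ring.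
    by rewrite ler_wpM2r ?mulr_ge0 ?exprn_ge0// lerDr.
  apply: le_trans (lerD (lerD t1 t2) t3) _.
  by rewrite le_eqVlt; apply/orP; left; apply/eqP; ring.
apply: le_trans key _; apply: ler_wpM2r.
  by rewrite mulr_ge0 ?powR_ge0// !addr_ge0// ?mulr_ge0 ?exprn_ge0//; lra.
(* The first term dominates [A] because [q <= X]; the second dominates [U] because
   [X ^ (1 / 4) <= q ^ (1 / 2)] and [1 <= A ^ (1 / 8)]. *)
rewrite /Rhs; apply: ler_wpDr; first by rewrite !mulr_ge0// powR_ge0.
apply: lerD.
  rewrite -mulrA ler_peMr// powRN ler_pdivlMr ?powR_gt0// [leLHS]mul1r.
  by apply: ge0_ler_powR; rewrite ?nnegrE ?ler_nat.
apply: le_trans UsqX _.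
have -> : X%:R `^ (1 / 2) = X%:R `^ (1 / 4) * X%:R `^ (1 / 4) :> R.
  by rewrite -powRD ?gt_eqF ?implybT//; congr (_ `^ _); field.
have A8 : 1 <= A%:R `^ (1 / 8) :> R.
  by rewrite -[leLHS](powRr0 A%:R) ler_powR ?ler1n//; lra.
have X4 : X%:R `^ (1 / 4) <= q%:R `^ (1 / 2) :> R.
  rewrite (_ : 1 / 4 = (1 / 2) * (1 / 2)); last by field.
  by rewrite powRrM; apply: ge0_ler_powR; rewrite ?nnegrE ?powR_ge0.
apply: ler_pM => //; rewrite ?powR_ge0// -[leLHS]mul1r.
by apply: ler_pM => //; rewrite powR_ge0.
Qed.
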